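(* Let $d$ be a translation-invariant distance on $\mathbb{R}$ that induces the standard topology of $\mathbb{R}$, and assume that $(\mathbb{R},d)$ has relatively compact balls. Then $(\mathbb{R},d)$ has Nagata dimension $1$ if and only if $(\mathbb{R},d)$ is linearly connected.
   Context: A distance $d$ on $\mathbb{R}$ is translation-invariant if $d(x,y)=d(x+v,y+v)$ for all $x,y,v\in\mathbb{R}$. A metric space has relatively compact balls (is proper) if all its closed balls are compact. A metric space $X$ is linearly connected if there is $\lambda\ge 1$ such that for all $x,y\in X$ there is a connected subset $S\subset X$ containing $x$ and $y$ with $\operatorname{diam}(S)\le \lambda d(x,y)$. Nagata dimension: for a cover $\mathcal{B}$ of a metric space $X$ and $s>0$, the $s$-multiplicity of $\mathcal{B}$ is the infimum of all $n$ such that every subset of $X$ of diameter $\le s$ meets at most $n$ members of $\mathcal{B}$. The cover $\mathcal{B}$ is $D$-bounded if $\operatorname{diam} B\le D$ for all $B\in\mathcal{B}$. The Nagata dimension $\dim_N X$ is the infimum of all integers $n\geq 0$ for which there exists a constant $c>0$ such that, for all $s>0$, $X$ admits a $cs$-bounded cover with $s$-multiplicity at most $n+1$. *)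

(* Defs.v *)
From HB Require Import structures.
From mathcomp Require Import all_boot all_order all_algebra.
From mathcomp Require Import all_classical all_reals all_analysis.

Set Implicit Arguments.
Unset Strict Implicit.
Unset Printing Implicit Defensive.

Import Order.TTheory GRing.Theory Num.Theory.
Import numFieldNormedType.Exports.

Local Open Scope classical_set_scope.
Local Open Scope ring_scope.

(* Nonnegativity follows from the other axioms. *)
Record distance (R : realType) (T : Type) := Distance {
  dist_fun :> T -> T -> R ;
  dist_xx : forall x, dist_fun x x = 0 ;
  dist_eq0 : forall x y, dist_fun x y = 0 -> x = y ;
  dist_sym : forall x y, dist_fun x y = dist_fun y x ;
  dist_triangle : forall y x z, dist_fun x z <= dist_fun x y + dist_fun y z }.

(* [metric_space d] is an alias of [T] whose topology is the one induced by
   [d], irrespective of any topology that [T] already carries. *)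
Definition metric_space (R : realType) (T : choiceType) (d : distance R T) :
  Type := T.

HB.instance Definition _ (R : realType) (T : choiceType) (d : distance R T) :=
  Choice.on (metric_space d).
HB.instance Definition _ (R : realType) (T : choiceType) (d : distance R T) :=
  @isMetric.Build R (metric_space d) d
    (dist_xx d) (@dist_eq0 R T d) (dist_sym d) (dist_triangle d).

Definition translation_invariant (R : realType) (d : distance R R) : Prop :=
  forall x y v : R, d x y = d (x + v) (y + v).

Definition induces_standard_topology (R : realType) (d : distance R R) :
  Prop :=
  forall A : set R, @open (metric_space d) A <-> @open R A.

Section MetricNotions.
Context {R : realType} (X : metricType R).

(* The maximum with 0 only matters for the empty set, whose supremum is -oo. *)
Definition diam (A : set X) : \bar R :=
  maxe 0%E (ereal_sup [set e | exists x y : X,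
    [/\ A x, A y & e = (mdist x y)%:E]]).

(* The library's [closed_ball] is the closure of the open ball, which may be
   strictly smaller than the ball used here. *)
Definition proper_space : Prop :=
  forall (x : X) (r : R), compact [set y : X | mdist x y <= r].

Definition linearly_connected : Prop :=
  exists lambda : R, 1 <= lambda /\
    forall x y : X, exists S : set X,
      [/\ connected S, S x, S y & (diam S <= (lambda * mdist x y)%:E)%E].

(* Infimum in [0, +oo]: it is +oo when no integer satisfies [P]. *)
Definition nat_inf (P : set nat) : \bar R :=
  ereal_inf [set (n%:R)%:E | n in P].

Definition is_cover (B : set (set X)) : Prop := \bigcup_(U in B) U = setT.

Definition multiplicity (s : R) (B : set (set X)) : \bar R :=
  nat_inf [set n | forall A : set X, (diam A <= s%:E)%E ->
    ([set U | B U /\ U `&` A !=set0] #<= `I_n)%card].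

Definition bounded_cover (D : R) (B : set (set X)) : Prop :=
  is_cover B /\ forall U, B U -> (diam U <= D%:E)%E.

Definition nagata_dim : \bar R :=
  nat_inf [set n | exists c : R, 0 < c /\
    forall s : R, 0 < s -> exists B : set (set X),
      bounded_cover (c * s) B /\ (multiplicity s B <= (n.+1%:R)%:E)%E].

End MetricNotions.

(* Main.v *)
Require Import Defs.
From mathcomp Require Import all_boot all_order all_algebra.
From mathcomp Require Import all_classical all_reals all_analysis.
From mathcomp Require Import zify lra.
From Stdlib Require Import Relation_Operators.

Set Implicit Arguments.
Unset Strict Implicit.
Unset Printing Implicit Defensive.

Import Order.TTheory GRing.Theory Num.Theory.
Import numFieldNormedType.Exports.

Local Open Scope classical_set_scope.
Local Open Scope ring_scope.

(** Write N v = d 0 v; then d a b = N (b - a).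

    Both directions go through one inequality: the metric line is linearly
    connected exactly when N t <= lambda * N x for 0 <= t <= x and some fixed
    lambda, because a connected set containing x and y contains the segment between them.
    Given this inequality, half-open intervals whose length is comparable to
    the largest t with N t <= s form a cover of diameter O(s), and a set of
    diameter at most s meets at most two of them. Dimension 0 never occurs:
    with multiplicity 1 a member is closed under small steps, hence is the
    whole line, and d would vanish.

    The substance is the converse. Fix s and a cover at scale 2s with
    multiplicity 2 and members of diameter at most D, and send each point to
    a member containing it; the line becomes a path in the nerve, a graph.
    If N z <= s, the loop of the nerve obtained by running from v to v + z and
    jumping back moves homotopically with v. As v tends to infinity the loop
    leaves every bounded part of the graph, so it crosses each edge an even
    number of times. Hence the number, mod 2, of crossings of a given edge
    between v and infinity is a function h of v (parity) that changes along
    steps of length at most s only where the step itself crosses the edge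
    (parity_cross): every edge behaves like an edge of a tree. A path from 0
    to infinity must cross an odd number of times some edge on the frontier
    of a large ball (parity_odd). After recentring on that edge one obtains a
    cut: a two-valued function h, constant along short steps away from a small
    chain-connected set E around 0, with h = 0 near +oo and h e = 1 at some
    e far from E (cover_cut).

    Translation invariance makes all translates of a cut available, and two
    translates with disjoint sets E are nested (cut_one_side, cut_nested).
    If h = 0 near -oo as well, then {h = 1} is bounded and nonempty, and the
    cut translated by e has {h = 1} + e inside {h = 1}, which is absurd
    (cut_false_no_bounded_side). So h separates -oo from +oo, and nesting
    orders the translates: h t = 0 and h (- t) = 1 whenever t > 0 and N t is
    large (cut_monotone). If 0 < t < x with N x <= s and N t large, then
    h (- t) = 1 and h (x - t) = 0, although these two points are s-close and
    far from E, a contradiction. So N t = O(s), and s = N x gives the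
    inequality. *)

(** * Proper lengths on the line *)

Record proper_length (R : realType) (N : R -> R) : Prop := ProperLength {
  length0 : N 0 = 0 ;
  lengthN : forall v, N (- v) = N v ;
  lengthD : forall v w, N (v + w) <= N v + N w ;
  length_small : forall s, 0 < s ->
    exists eta, 0 < eta /\ forall v, `|v| <= eta -> N v <= s ;
  length_bounded : forall r, exists M, forall v, N v <= r -> `|v| < M }.

Section Length.
Context {R : realType}.

(** The form in which connectedness of the line is used throughout: a property
    that propagates along small enough steps is all or nothing. *)
Lemma small_steps_connect (Q : R -> Prop) (eta : R) : 0 < eta ->
  (forall a b, `|b - a| <= eta -> Q a -> Q b) -> forall v w, Q v -> Q w.
Proof.
move=> eta0 step v w Qv.
pose n := (Num.truncn (`|w - v| / eta)).+1.
have n0 : 0 < n%:R :> R by rewrite ltr0n.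
have hn : `|w - v| <= n%:R * eta.
  have /andP[_ /ltW] : (Num.truncn (`|w - v| / eta))%:R <= `|w - v| / eta < n%:R.
    by apply: truncn_itv; rewrite divr_ge0// ltW.
  by rewrite ler_pdivrMr.
have Qi i : Q (v + i%:R * ((w - v) / n%:R)).
  elim: i => [|i IH]; first by rewrite mul0r addr0.
  apply: step IH.
  rewrite (_ : _ - _ = (w - v) / n%:R); last by rewrite -natr1; lra.
  by rewrite normrM normfV (gtr0_norm n0) ler_pdivrMr// mulrC.
by have := Qi n; rewrite mulrC divfK ?gt_eqF// addrC subrK.
Qed.

Context (N : R -> R) (hN : proper_length N).

Lemma lengthB a b : N (b - a) = N (a - b).
Proof. by rewrite -(lengthN hN) opprB. Qed.

Lemma length_ge0 v : 0 <= N v.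
Proof.
have := lengthD hN v (- v); rewrite subrr (length0 hN) (lengthN hN); lra.
Qed.

Lemma lengthD_rev v w : N w - N v <= N (v + w).
Proof.
by have := lengthD hN (v + w) (- v); rewrite addrAC subrr add0r (lengthN hN); lra.
Qed.

(** * Cuts and their translates *)

(** A coarse two-sided separator: [E] plays the role of the separator, [h]
    tells its two sides apart at the scale [s]. The field [cut_conn] says that
    [E] is connected through [s]-chains of the ball of radius [rho], phrased
    through the functions that such chains preserve. *)
Record cut (s rho : R) (E : set R) (h : R -> bool) : Prop := Cut {
  cut_base : E 0 ;
  cut_radius : forall v, E v -> N v <= rho ;
  cut_conn : forall g : R -> bool,
    (forall a b, N a <= rho -> N b <= rho -> N (b - a) <= s -> g a = g b) ->
    forall v, E v -> g v = g 0 ;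
  cut_jump : forall a b, N (b - a) <= s -> h a != h b -> E a }.

(** Translating by [t] again and again would push [v] past [M]. *)
Lemma shift_not_stable (h : R -> bool) (t M v : R) : 0 < t ->
  (forall v, M <= v -> ~~ h v) -> (forall v, h (v - t) -> h v) -> h v -> False.
Proof.
move=> t0 hM sub hv.
have hn n : h (v + n%:R * t).
  elim: n => [|n IH]; first by rewrite mul0r addr0.
  apply: sub; rewrite (_ : _ - _ = v + n%:R * t)//.
  by rewrite -natr1; lra.
have := truncn_itv (normr_ge0 ((M - v) / t)) => /andP[_].
set n := (Num.truncn _).+1 => /ltW /(le_trans (ler_norm _)).
rewrite ler_pdivrMr// => hMn.
by have := hM (v + n%:R * t); rewrite hn => /(_ ltac:(lra)).
Qed.

Section OneCut.
Context (s rho : R) (s_gt0 : 0 < s) (E : set R) (h : R -> bool).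
Context (hc : cut s rho E h).

Lemma cut_step a b : N (b - a) <= s -> ~ E a -> h a = h b.
Proof.
by move=> ab nE; apply/eqP; apply: contrapT => /negP /(cut_jump hc ab).
Qed.

(** The chains that connect [E + t] run in the ball of radius [rho] around [t],
    which avoids [E]. They meet no jump of [h], so [E + t] lies on a single side
    of the cut. *)
Lemma cut_const_far t : 2 * rho < N t -> forall v, E v -> h (v + t) = h t.
Proof.
move=> ht v Ev; rewrite -{2}(add0r t).
apply: (cut_conn hc (g := fun v => h (v + t))) Ev => a b ha hb ab.
apply: cut_step; first by rewrite opprD addrACA subrr addr0.
by move=> /(cut_radius hc); have := lengthD_rev a t; lra.
Qed.

(** Otherwise the point [w] lies on the other side from [E + t] with respect
    to [E], and on the other side from [E] with respect to [E + t]. Moving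
    along the line from [w] one never enters [E] or [E + t], since that
    would change sides first; but the line contains [t]. *)
Lemma cut_one_side t : 2 * rho < N t ->
  forall w, h w = h t \/ h (w - t) = h (- t).
Proof.
move=> ht w; apply: contrapT => /not_orP[hw hwt].
have [eta [eta0 small]] := length_small hN s_gt0.
have htN : 2 * rho < N (- t) by rewrite lengthN.
suff : h t = h w /\ h (t - t) = h (w - t) by case=> /esym.
apply: (small_steps_connect (Q := fun a => h a = h w /\ h (a - t) = h (w - t))
  eta0 _ (v := w)) => // a b /small ab [ha hat].
split.
- rewrite -ha; apply/esym/cut_step => // Ea.
  by apply: hwt; rewrite -hat cut_const_far.
- rewrite -hat; apply/esym/cut_step; first by rewrite opprB addrA subrK.
  by move=> /(cut_const_far ht); rewrite subrK ha.
Qed.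

(** The side of [E + t] that contains [v] but not [E] is attached to [E + t]:
    moving from [v] to [w], which is not on that side, one leaves it through
    [E + t] and does not meet [E] before. So [v] and [E + t] are on the same side of [E]. *)
Lemma cut_nested t v : 2 * rho < N t -> h (v - t) != h (- t) ->
  (exists w, h (w - t) != h (v - t)) -> h v = h t.
Proof.
move=> ht hvt [w hw].
have [eta [eta0 small]] := length_small hN s_gt0.
have htN : 2 * rho < N (- t) by rewrite lengthN.
suff : h (v - t) = h (v - t) -> h v = h t by apply.
apply: (small_steps_connect
  (Q := fun a => h (a - t) = h (v - t) -> h a = h t) eta0 _ (v := w)).
  move=> b a /small; rewrite lengthB => ab IH hat.
  have abt : N (b - t - (a - t)) <= s by rewrite opprB addrA subrK.
  case: (eqVneq (h (b - t)) (h (v - t))) => [hbt|hbt].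
    rewrite -IH//; apply: cut_step => // Ea.
    by move: hvt; rewrite -hat cut_const_far// eqxx.
  rewrite -(subrK t a); apply: cut_const_far => //.
  by apply: (cut_jump hc abt); rewrite hat eq_sym.
by move=> e; rewrite e eqxx in hw.
Qed.

Context (M : R) (hR : forall v, M <= v -> ~~ h v).

(** Both ends being on the side [~~ h], the other side is bounded. Were [t] on
    that bounded side and far from [E], the bounded side of the cut translated
    by [t] would be nested in the original one. *)
Lemma cut_false_no_bounded_side t : (forall v, v <= - M -> ~~ h v) ->
  2 * rho < N t -> ~~ h t.
Proof.
move=> hL ht; apply/negP => h_t.
have htN : ~~ h (- t).
  have [|] := cut_one_side ht (Num.max M (M + t)).
    by rewrite h_t (negbTE (hR _))// le_max lexx.
  by move=> <-; apply: hR; rewrite lerBrDr le_max lexx orbT.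
have sub v : h (v - t) -> h v.
  move=> hv; rewrite (cut_nested (t := t) (v := v))// ?hv ?(negbTE htN)//.
  by exists (M + t); rewrite addrK (negbTE (hR _)).
have rho0 : 0 <= rho by rewrite -(length0 hN); apply/(cut_radius hc)/(cut_base hc).
case: (ltgtP t 0) => t0.
- apply: (@shift_not_stable (fun v => h (- v)) (- t) M (- t)).
  + by rewrite oppr_gt0.
  + by move=> v Mv; apply: hL; rewrite lerN2.
  + by move=> v; rewrite opprB addrC => /sub.
  + by rewrite opprK.
- exact: (shift_not_stable t0 hR sub h_t).
- by move: ht; rewrite t0 (length0 hN); lra.
Qed.

(** When the cut separates the two ends, its translates are linearly ordered,
    and the order must agree with that of the line: if translating by [t > 0]
    moved the cut towards -oo, iterating would contradict [hR]. *)
Lemma cut_monotone t : (forall v, v <= - M -> h v) -> 0 < t ->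
  2 * rho < N t -> h t = false /\ h (- t).
Proof.
move=> hL t0 ht.
set w := Num.max M (M + t); set u := Num.min (- M) (- M + t).
have wR : h w = false by apply/negbTE/hR; rewrite le_max lexx.
have wtR : h (w - t) = false.
  by apply/negbTE/hR; rewrite lerBrDr le_max lexx orbT.
have uL : h u by apply: hL; rewrite ge_min lexx.
have utL : h (u - t) by apply: hL; rewrite lerBlDr ge_min lexx orbT.
have := cut_one_side ht u; rewrite uL utL.
have := cut_one_side ht w; rewrite wR wtR.
move=> [h_t|hNt] [h_t'|h_t'].
- by rewrite -h_t in h_t'.
- by rewrite -h_t -h_t'.
- exfalso; apply: (shift_not_stable t0 hR _ (esym h_t')) => v hv.
  rewrite (cut_nested (t := t) (v := v))// ?hv -?hNt//.
  by exists (M + t); rewrite addrK (negbTE (hR _)).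
- by rewrite -hNt in h_t'.
Qed.

End OneCut.

(** Far to the left the line stays away from [E], so [h] has a value at -oo. *)
Lemma cut_left_end s rho E h : 0 < s -> cut s rho E h ->
  exists M, forall v w, v <= - M -> w <= - M -> h v = h w.
Proof.
move=> s0 hc; have [eta [eta0 small]] := length_small hN s0.
have [M hM] := length_bounded hN rho; exists M => v w hv hw.
suff : h (Num.min v (- M)) = h w by rewrite min_l.
apply: (small_steps_connect (Q := fun a => h (Num.min a (- M)) = h w)
  eta0 _ (v := w)); last by rewrite min_l.
move=> a b ab <-; apply/esym/(cut_step hc).
  apply: small; apply: le_trans ab.
  have := ler_norm (b - a); have := ler_norm (a - b); rewrite distrC ler_norml.
  case: (leP a (- M)) => ?; case: (leP b (- M)) => ? ? ?; apply/andP; split; lra.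
move=> /(cut_radius hc)/hM; rewrite ltr_norml => /andP[+ _].
by rewrite ltNge ge_min lexx orbT.
Qed.

(** The point [e] excludes that both ends are on the same side of the cut. Then,
    for [N t] too large, [h] would differ at [- t] and [x - t], whose difference
    has length at most [s] and which are both far from [E]. *)
Lemma cut_length_bound s rho E h M e : 0 < s -> cut s rho E h ->
  (forall v, M <= v -> ~~ h v) -> h e -> 2 * rho < N e ->
  forall x t, 0 < t -> t <= x -> N x <= s -> N t <= 2 * rho + s.
Proof.
move=> s0 hc hR he Ne x t t0 tx Nx; rewrite leNgt; apply/negP => Nt.
have [M' hM'] := cut_left_end s0 hc.
pose M1 := Num.max M M'.
have hR1 v : M1 <= v -> ~~ h v by rewrite ge_max => /andP[/hR].
have hL v : v <= - M1 -> h v = h (- M1).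
  move=> hv; apply: hM' => //; first apply: le_trans hv _;
    by rewrite lerN2 le_max lexx orbT.
have [hl|hl] := boolP (h (- M1)); last first.
  have hl' v : v <= - M1 -> ~~ h v by move=> /hL ->.
  by have := cut_false_no_bounded_side s0 hc hR1 hl' Ne; rewrite he.
have mono u := cut_monotone s0 hc hR1 (t := u) (fun v hv => etrans (hL v hv) hl).
have rho0 : 0 <= rho by rewrite -(length0 hN); apply/(cut_radius hc)/(cut_base hc).
have xt : 2 * rho < N (x - t).
  by have := lengthD_rev (- x) t; rewrite (lengthN hN) [- x + t]addrC lengthB; lra.
have xt0 : 0 < x - t.
  rewrite lt_neqAle subr_ge0 tx andbT; apply/eqP => e0.
  by move: xt; rewrite -e0 (length0 hN); lra.
have [_ ht] := mono t t0 ltac:(lra).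
have [hxt _] := mono (x - t) xt0 xt.
have : h (- t) = h (x - t).
  apply: (cut_step hc); first by rewrite opprK subrK.
  by move=> /(cut_radius hc); rewrite (lengthN hN); lra.
by rewrite ht hxt.
Qed.
End Length.

(** * From covers of multiplicity two to cuts *)

(** The total parity is the sum of the parities of the fibres of [l]. The labels
    need not be enumerable, so the induction removes one fibre at a time. *)
Lemma xor_fiber (T : Type) (l : nat -> T) (x : nat -> bool) (r : seq nat) :
  \big[addb/false]_(i <- r) x i ->
  exists e, \big[addb/false]_(i <- r) (x i && `[< l i = e >]).
Proof.
have [n] := ubnP (size r); elim: n r => // n IH [|i0 r]; first by rewrite big_nil.
rewrite ltnS => sz; pose p i := `[< l i = l i0 >].
have restrict q : \big[addb/false]_(i <- i0 :: r) (x i && q i) =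
    \big[addb/false]_(i <- i0 :: r | q i) x i.
  rewrite [RHS]big_mkcond; apply: eq_bigr => i _.
  by case: (q i); rewrite ?andbT ?andbF.
case Ep : (\big[addb/false]_(i <- i0 :: r) (x i && p i)).
  by exists (l i0); rewrite Ep.
rewrite (bigID p)/= -restrict Ep addFb -big_filter => /IH[].
  rewrite /= /p asboolT//= size_filter.
  by apply: leq_ltn_trans (count_size _ _) _.
move=> e he; exists e; move: he; rewrite big_filter big_mkcond.
case: (pselect (e = l i0)) => [->|ne].
  rewrite big1// => i _; case: (boolP (p i)) => //= pi.
  by rewrite -/(p i) (negbTE pi) andbF.
rewrite (eq_bigr (fun i => x i && `[< l i = e >]))// => i _.
case: ifP => // /negbFE/asboolP ->; rewrite asboolF ?andbF//; exact/nesym.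
Qed.

Section Cover.
Context {R : realType} (N : R -> R) (hN : proper_length N).
(* [psi] selects a member of the cover around each point; the selected members
   are the vertices of the nerve, and [psi_two] is multiplicity two. *)
Context (s D : R) (s_gt0 : 0 < s) (psi : R -> set R).
Context (psi_self : forall v, psi v v).
Context (psi_diam : forall v a b, psi v a -> psi v b -> N (b - a) <= D).
Context (psi_two : forall a b c,
  N (b - a) <= 2 * s -> N (c - b) <= 2 * s -> N (c - a) <= 2 * s ->
  [\/ psi a = psi b, psi b = psi c | psi a = psi c]).

(** An edge of the nerve, seen as the union of its two vertices. *)
Definition edge a b : set R := [set v | psi v = psi a \/ psi v = psi b].

Definition link (Z : set R) a b := [/\ Z a, Z b & N (b - a) <= s].

Definition component (Z : set R) a : set R :=
  [set v | clos_refl_sym_trans R (link Z) a v].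

Context (r : R).

(** This depends on [v] only through the vertex [psi v]; the frontier consists of
    the edges of the nerve joining an inner vertex to one that is not. *)
Definition inner v : bool := `[< exists w, psi v w /\ N w <= r >].

(** Whether the step from [a] to [b] crosses the frontier through [E]. The
    frontier crossings are sorted not by the edge of the nerve but by the
    [s]-chain component of that edge in which they take place, so that [E] is
    connected as a cut requires. *)
Definition cross (E : set R) a b : bool :=
  (inner a (+) inner b) && `[< component (edge a b) a = E >].

Lemma component_eq Z a b : component Z a b -> component Z a = component Z b.
Proof.
move=> ab; apply/seteqP; split => v /= h.
  by apply: rst_trans h; apply: rst_sym.
by apply: rst_trans h.
Qed.

Lemma component_const (T : Type) (f : R -> T) Z a b :
  (forall v w, link Z v w -> f v = f w) -> component Z a b -> f a = f b.
Proof. by move=> hf; elim=> {a b} [v w /hf|//|v w _ ->|u v w _ -> _ ->]. Qed.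

Lemma component_sub Z a b : component Z a b -> Z a -> Z b.
Proof.
move=> ab; suff -> : Z a = Z b by [].
by apply: component_const ab => v w [Zv Zw _]; apply/propext; split.
Qed.

Lemma inner_psi a b : psi a = psi b -> inner a = inner b.
Proof. by rewrite /inner => ->. Qed.

(** The cocycle identity behind homotopy invariance. The four corners have
    diameter at most [2 * s], so at most two members occur among them. If both
    are on the same side of the frontier nothing is crossed; otherwise the four
    steps run along one component of one edge, where crossings are counted by
    the change of [inner]. *)
Lemma cross_square E a b e : N e <= s -> N (b - a) <= s ->
  cross E a (a + e) (+) cross E b (b + e) =
  cross E a b (+) cross E (a + e) (b + e).
Proof.
move=> he hab.
have De v w : N (v + e - (w + e)) = N (v - w) by rewrite opprD addrACA subrr addr0.
have Ve v : N (v + e - v) = N e by rewrite addrAC subrr add0r.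
have h1 : N (b + e - a) <= 2 * s.
  by have := lengthD hN (b - a) e; rewrite addrAC; lra.
have h2 : N (b - (a + e)) <= 2 * s.
  by have := lengthD hN (b - a) (- e); rewrite (lengthN hN) opprD addrA; lra.
have le2 x : x <= s -> x <= 2 * s by move: s_gt0 => /= *; lra.
(* [V] is the second member, if any, that occurs at the corners. *)
have [V hV] : exists V, [/\ psi (a + e) = psi a \/ psi (a + e) = V,
    psi b = psi a \/ psi b = V & psi (b + e) = psi a \/ psi (b + e) = V].
  have T1 := @psi_two a (a + e) b ltac:(by rewrite Ve le2) h2 (le2 _ hab).
  have T2 := @psi_two a (a + e) (b + e)
    ltac:(by rewrite Ve le2) ltac:(by rewrite De le2) h1.
  have T3 := @psi_two a b (b + e) (le2 _ hab) ltac:(by rewrite Ve le2) h1.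
  case: (pselect (psi (a + e) = psi a)) => [e1|n1].
    case: (pselect (psi b = psi a)) => [e2|n2].
      by exists (psi (b + e)); split; [left|left|right].
    exists (psi b); split; [by left|by right|].
    by case: T3 => t; [case: n2|right|left].
  exists (psi (a + e)); split; [by right| |].
  - by case: T1 => t; [case: n1|right|left].
  - by case: T2 => t; [case: n1|right|left].
case: hV => hae hb hbe.
pose Z : set R := [set v | psi v = psi a \/ psi v = V].
have Za : Z a by left.
have crossZ p q : Z p -> Z q -> component Z a p ->
    cross E p q = (inner p (+) inner q) && `[< component Z a = E >].
  move=> Zp Zq ap; rewrite /cross.
  case: (boolP (inner p (+) inner q)) => //= pq.
  have npq : psi p <> psi q by move=> /inner_psi; move: pq; case: inner; case: inner.
  suff -> : edge p q = Z by rewrite -(component_eq ap).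
  rewrite /edge /Z; case: Zp => ep; case: Zq => eq_; rewrite ep eq_ in npq *.
  - by [].
  - by [].
  - by apply/seteqP; split => v /= [] ->; [right|left|right|left].
  - by [].
have [abl abr abe] : [/\ link Z a b, link Z a (a + e) & link Z b (b + e)].
  by split; split=> //; rewrite Ve.
have Ka : component Z a a by apply: rst_refl.
have Kb : component Z a b by apply: rst_step.
have Kae : component Z a (a + e) by apply: rst_step.
have Kbe : component Z a (b + e) by apply: rst_trans Kb _; apply: rst_step.
rewrite !crossZ//; case: `[< _ >]; rewrite ?andbF// !andbT.
by do 4 case: inner.
Qed.

Lemma inner_bounded : exists M, forall v, M <= v -> ~~ inner v.
Proof.
have [M hM] := length_bounded hN (r + D); exists M => v Mv.
apply/negP => /asboolP[w [vw Nw]].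
have := hM v; rewrite ltNge (le_trans Mv (ler_norm v)) => /(_ _)/negP[]//.
have := lengthD hN w (v - w); rewrite addrC subrK.
by have := psi_diam vw (psi_self v); lra.
Qed.

Lemma cross_component E p q : N (q - p) <= s -> cross E p q -> E p /\ E q.
Proof.
move=> pq /andP[_ /asboolP <-]; split; first exact: rst_refl.
by apply: rst_step; split; [left|right|].
Qed.

(** A member of the cover has diameter at most [D], and the two members of an
    edge are joined by a step of length at most [s]. *)
Lemma edge_radius p q v : N (q - p) <= s -> edge p q v ->
  N (v - p) <= D + s.
Proof.
move=> pq [vp|vq].
  have vp' : psi p v by rewrite -vp.
  by have := psi_diam (psi_self p) vp'; have := s_gt0; lra.
have vq' : psi q v by rewrite -vq.
have := psi_diam (psi_self q) vq'.
have := lengthD hN (v - q) (q - p); rewrite addrA subrK; lra.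
Qed.

Section Crossings.
Context (eps : R) (eps_gt0 : 0 < eps) (Neps : N eps <= s).

(** The parity of the number of crossings through [E] along the grid path of
    [n] steps starting at [v]. *)
Definition crossings E n v : bool :=
  \big[addb/false]_(i <- iota 0 n) cross E (v + i%:R * eps) (v + i%:R * eps + eps).

Lemma crossingsS E n v : crossings E n.+1 v =
  crossings E n v (+) cross E (v + n%:R * eps) (v + n%:R * eps + eps).
Proof. by rewrite /crossings -addn1 iotaD big_cat/= big_cons big_nil addbF. Qed.

Lemma stepS n (v : R) : v + n%:R * eps + eps = v + n.+1%:R * eps.
Proof. by rewrite -natr1 mulrDl mul1r addrA. Qed.

(** Homotopy invariance: the squares between the two grid paths telescope, and
    only the two ends remain. *)
Lemma crossings_square E n a b : N (b - a) <= s ->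
  crossings E n a (+) crossings E n b =
  cross E a b (+) cross E (a + n%:R * eps) (b + n%:R * eps).
Proof.
move=> ab; elim: n => [|n IH].
  by rewrite /crossings !big_nil mul0r !addr0 !addbb.
have abn : N (b + n%:R * eps - (a + n%:R * eps)) <= s.
  by rewrite (_ : _ - _ = b - a)//; lra.
rewrite !crossingsS addbACA IH (cross_square _ Neps abn) -!stepS.
by rewrite addbA -(addbA (cross E a b)) addbb addbF.
Qed.

Lemma inner_telescope n v :
  \big[addb/false]_(i <- iota 0 n)
    (inner (v + i%:R * eps) (+) inner (v + i%:R * eps + eps)) =
  inner v (+) inner (v + n%:R * eps).
Proof.
elim: n => [|n IH]; first by rewrite big_nil mul0r addr0 addbb.
rewrite -addn1 iotaD big_cat/= big_cons big_nil addbF IH add0n addn1 stepS.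
by rewrite addbA -(addbA (inner v)) addbb addbF.
Qed.

Context (M : R) (outerM : forall v, M <= v -> ~~ inner v).

Lemma cross_outer E a b : M <= a -> M <= b -> cross E a b = false.
Proof. by move=> /outerM/negbTE ha /outerM/negbTE hb; rewrite /cross ha hb. Qed.

Definition reach v := (Num.truncn (`|M - v| / eps)).+1.

Lemma reachP v n : (reach v <= n)%N -> M <= v + n%:R * eps.
Proof.
move=> vn; have : `|M - v| / eps < n%:R.
  apply: lt_le_trans (_ : (reach v)%:R <= _); last by rewrite ler_nat.
  by have /andP[] := truncn_itv (divr_ge0 (normr_ge0 (M - v)) (ltW eps_gt0)).
by rewrite ltr_pdivrMr//; have := ler_norm (M - v); lra.
Qed.

(** The parity of the crossings through [E] between [v] and +oo; beyond [M]
    there are none. *)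
Definition parity E v := crossings E (reach v) v.

Lemma crossings_parity E v n : (reach v <= n)%N -> crossings E n v = parity E v.
Proof.
move=> /subnKC <-; elim: (n - _)%N => [|k IH]; first by rewrite addn0.
rewrite addnS crossingsS IH cross_outer ?addbF ?stepS//; apply: reachP.
- exact: leq_addr.
- by rewrite -addnS leq_addr.
Qed.

(** Homotopy invariance with one end at +oo, where nothing is crossed: this is
    where properness forces the nerve to look like a tree. *)
Lemma parity_cross E a b : N (b - a) <= s ->
  parity E a (+) parity E b = cross E a b.
Proof.
move=> ab; pose n := maxn (reach a) (reach b).
rewrite -(@crossings_parity E a n) ?leq_maxl//.
rewrite -(@crossings_parity E b n) ?leq_maxr//.
rewrite crossings_square// [X in _ (+) X]cross_outer ?addbF//; apply: reachP.
- exact: leq_maxl.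
- exact: leq_maxr.
Qed.

Lemma parity_outer E v : M <= v -> ~~ parity E v.
Proof.
move=> Mv; rewrite /parity /crossings big1// => i _.
have ie : 0 <= i%:R * eps by rewrite mulr_ge0// ltW.
by apply: cross_outer; move: eps_gt0 => /= ?; lra.
Qed.

(** A path from an inner point to +oo crosses the frontier an odd number of
    times, hence crosses some component an odd number of times. *)
Lemma parity_odd : inner 0 -> exists p q, [/\ N (q - p) <= s,
  inner p != inner q & parity (component (edge p q) p) 0].
Proof.
move=> in0; pose x i := (0 + i%:R * eps : R).
have := inner_telescope (reach 0) 0.
rewrite in0 (negbTE (outerM (reachP (leqnn _))))/= => /xor_fiber.
move=> /(_ _ (fun i => component (edge (x i) (x i + eps)) (x i)))[E oddE].
have {}oddE : parity E 0 by [].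
have [i Ei] : exists i, cross E (x i) (x i + eps).
  apply: contrapT => /forallNP none; move: oddE.
  by rewrite /parity /crossings big1// => i _; apply/negbTE/negP/none.
have /andP[io /asboolP hE] := Ei.
exists (x i), (x i + eps); split; last by rewrite hE.
  by rewrite addrAC subrr add0r.
by move: io; case: inner; case: inner.
Qed.

End Crossings.

(** The radius [r] is large enough for the frontier edge found by [parity_odd]
    to be far from 0. Recentring at the starting point [p] of a crossing moves
    0 to [- p], which becomes the witness of the side [h]. *)
Lemma cover_cut : 2 * (D + s) + s <= r -> exists E h M e,
  [/\ cut N s (D + s) E h, forall v, M <= v -> ~~ h v, h e & 2 * (D + s) < N e].
Proof.
move=> hr.
have [eps [eps0 /(_ eps)]] := length_small hN s_gt0.
rewrite gtr0_norm// => /(_ (lexx _)) Neps.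
have [M outerM] := inner_bounded.
have in0 : inner 0.
  apply/asboolP; exists 0; split; first exact: psi_self.
  have := psi_diam (psi_self 0) (psi_self 0).
  by rewrite subrr (length0 hN); have := s_gt0; lra.
have [p [q [pq ipq odd0]]] := parity_odd eps0 Neps outerM in0.
have diffE a b : N (b - a) <= s -> parity eps M (component (edge p q) p) a !=
    parity eps M (component (edge p q) p) b ->
    cross (component (edge p q) p) a b.
  move=> ab; rewrite -(parity_cross eps0 Neps outerM _ ab).
  by case: parity; case: parity.
have shiftE (a b : R) : b + p - (a + p) = b - a by lra.
have in_radius v : component (edge p q) p v -> N (v - p) <= D + s.
  by move=> /component_sub vp; apply: (edge_radius pq); apply: vp; left.
exists [set v | component (edge p q) p (v + p)],
  (fun v => parity eps M (component (edge p q) p) (v + p)), (M - p), (- p).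
split.
- split.
  + by rewrite /= add0r; apply: rst_refl.
  + by move=> v /in_radius; rewrite addrK.
  + move=> g hg v /= vp; have <- : g (v + p - p) = g v by rewrite addrK.
    have <- : g (p - p) = g 0 by rewrite subrr.
    apply/esym.
    apply: (@component_const _ (fun v => g (v - p)) _ _ _ _ vp) => a b [Za Zb ab].
    apply: hg; [exact: (edge_radius pq Za)|exact: (edge_radius pq Zb)|].
    by rewrite opprB addrA subrK.
  + move=> a b; rewrite -(shiftE a b) => ab hab.
    by have [] := cross_component ab (diffE _ _ ab hab).
- by move=> v Mv; apply: (parity_outer eps0 outerM); rewrite -lerBlDr.
- by rewrite addNr.
- rewrite (lengthN hN) ltNge; apply/negP => Np.
  have ip : inner p.
    by apply/asboolP; exists p; split; [exact: psi_self|have := s_gt0; lra].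
  have iq : inner q.
    apply/asboolP; exists q; split; first exact: psi_self.
    by have := lengthD hN p (q - p); rewrite addrC subrK; lra.
  by move: ipq; rewrite ip iq.
Qed.

Lemma cover_length_bound : 2 * (D + s) + s <= r -> forall x t,
  0 < t -> t <= x -> N x <= s -> N t <= 2 * (D + s) + s.
Proof.
move=> /cover_cut[E [h [M [e [hc hR he Ne]]]]].
exact: cut_length_bound hc hR he Ne.
Qed.

End Cover.

(** * Diameters, multiplicities and the Nagata dimension *)

Section Dimension.
Context {R : realType}.

Lemma nat_inf_leP (P : set nat) n :
  (nat_inf P <= (n%:R : R)%:E)%E <-> exists2 m, (m <= n)%N & P m.
Proof.
split=> [le_n|[m mn Pm]].
- apply: contrapT => none.
  suff : ((n.+1%:R : R)%:E <= nat_inf P)%E.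
    by move=> /le_trans/(_ le_n); rewrite lee_fin ler_nat ltnn.
  apply: le_ereal_inf_tmp => _ [m Pm <-]; rewrite lee_fin ler_nat ltnNge.
  by apply/negP => mn; apply: none; exists m.
- apply: (@le_trans _ _ (m%:R : R)%:E); last by rewrite lee_fin ler_nat.
  by apply: ereal_inf_lbound; exists m.
Qed.

Lemma nat_inf_eq1P (P : set nat) :
  nat_inf P = (1 : R)%:E <-> P 1%N /\ ~ P 0%N.
Proof.
split=> [inf1|[P1 nP0]].
- have nP0 : ~ P 0%N.
    move=> P0; have /nat_inf_leP : exists2 m, (m <= 0)%N & P m by exists 0%N.
    by rewrite inf1 lee_fin ler10.
  split => //; have /nat_inf_leP[[|[|//]] _ //] : (nat_inf P <= (1%:R : R)%:E)%E.
  by rewrite inf1.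
- apply/eqP; rewrite eq_le; apply/andP; split.
    by apply/(nat_inf_leP P 1); exists 1%N.
  apply: le_ereal_inf_tmp => _ [[|m] Pm <-] //.
  by rewrite lee_fin ler1n.
Qed.

Context (X : metricType R).

Lemma mdist_le_diam (A : set X) (r : R) x y :
  (diam A <= r%:E)%E -> A x -> A y -> mdist x y <= r.
Proof.
move=> hA Ax Ay; rewrite -lee_fin; apply: le_trans hA.
rewrite /diam le_max; apply/orP; right.
by apply: ereal_sup_ubound; exists x, y.
Qed.

Lemma diam_leP (A : set X) (r : R) : 0 <= r ->
  (forall x y, A x -> A y -> mdist x y <= r) -> (diam A <= r%:E)%E.
Proof.
move=> r0 hA; rewrite /diam ge_max lee_fin r0/=.
by apply: ge_ereal_sup => _ [x [y [Ax Ay ->]]]; rewrite lee_fin; apply: hA.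
Qed.

(** Multiplicity at most [n] in the form used for pigeonhole arguments: the
    members that meet [A] carry distinct labels below [n]. *)
Lemma multiplicity_label (s : R) (B : set (set X)) n (A : set X) :
  (multiplicity s B <= (n%:R)%:E)%E -> (diam A <= s%:E)%E ->
  exists f : set X -> nat, forall U V, B U -> B V -> U `&` A !=set0 ->
    V `&` A !=set0 -> (f U < n)%N /\ (f U = f V -> U = V).
Proof.
move=> /nat_inf_leP[m mn hm] /hm /pcard_leP[f].
exists f => U V BU BV UA VA; split.
  by apply: leq_trans mn; apply: (@funS _ _ _ _ f).
by move=> fUV; apply: (@inj _ _ _ f) => //; rewrite inE.
Qed.

End Dimension.

(** * Invariant distances on the line *)

Section InvariantDistance.
Context {R : realType} (d : distance R R).
Context (d_inv : translation_invariant d) (d_top : induces_standard_topology d).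
Let X := metric_space d.

Lemma dist_length a b : d a b = d 0 (b - a).
Proof. by rewrite (d_inv a b (- a)) subrr. Qed.

Lemma distance_length : proper_space X -> proper_length (d 0).
Proof.
move=> d_proper; split.
- exact: dist_xx.
- by move=> v; rewrite (d_inv 0 (- v) v) add0r addNr dist_sym.
- move=> v w; apply: le_trans (dist_triangle d v 0 (v + w)) _.
  by rewrite (dist_length v) addrAC subrr add0r.
- move=> s s0.
  have oB : @open X [set y | d 0 y < s].
    rewrite openE => y /= ys; apply/nbhs_ballP; exists (s - d 0 y).
      by rewrite /= subr_gt0.
    move=> z; rewrite ballEmdist /= => yz.
    by apply: le_lt_trans (dist_triangle d y 0 z) _; rewrite addrC -ltrBrDr.
  have /d_top oB' := oB.
  have : nbhs (0 : R) [set y | d 0 y < s].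
    by apply: open_nbhs_nbhs; split => //=; rewrite dist_xx.
  move=> /nbhs_ballP[e /= e0 he]; exists (e / 2); split; first by rewrite divr_gt0.
  move=> v ve; apply/ltW/he; rewrite /ball/= sub0r normrN.
  by apply: le_lt_trans ve _; rewrite ltr_pdivrMr// ltr_pMr// ltr1n.
- move=> r.
  have cont : continuous (id : X -> R^o).
    apply/continuousP => A oA; exact/d_top.
  have := continuous_compact (continuous_subspaceT cont) (d_proper 0 r).
  move=> /compact_bounded /ex_strict_bound_gt0[M _ hM].
  exists M => v hv; apply: hM; by exists v.
Qed.

Lemma length_gt0 v : proper_length (d 0) -> v != 0 -> 0 < d 0 v.
Proof.
move=> hN v0; rewrite lt_neqAle length_ge0// andbT eq_sym.
by apply: contra_neq v0 => d0; rewrite -(dist_eq0 d0).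
Qed.

(** With multiplicity 1, points at distance at most [s] share their member, so a
    single member contains 0 and 1; for small [s] its diameter is below
    [d 0 1]. *)
Lemma no_dim0_covers : proper_length (d 0) -> forall c, 0 < c ->
  ~ (forall s, 0 < s -> exists B : set (set X),
     bounded_cover (c * s) B /\ (multiplicity s B <= (1%:R)%:E)%E).
Proof.
move=> hN c c0 hcov.
have N1 : 0 < d 0 1 by apply: length_gt0; rewrite ?oner_neq0.
pose s := d 0 1 / 2 / c.
have s0 : 0 < s by rewrite !divr_gt0.
have [B [[covB diamB] mulB]] := hcov s s0.
have [eta [eta0 small]] := length_small hN s0.
have [U BU U0] : exists2 U, B U & U (0 : X).
  by have : (\bigcup_(U in B) U) (0 : X) by rewrite covB.
suff U1 : U (1 : X).
  have := mdist_le_diam (diamB U BU) U0 U1.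
  rewrite /s [c * _]mulrC divfK ?gt_eqF// => ?.
  by have : d 0 1 <= d 0 1 / 2 by []; lra.
apply: (@small_steps_connect R (fun v : R => U v) eta eta0 _ 0) => // a b.
move=> /small ab Ua.
have [V BV Vb] : exists2 V, B V & V (b : X).
  by have : (\bigcup_(U in B) U) (b : X) by rewrite covB.
have dA : (@diam R X [set a; b] <= s%:E)%E.
  apply: diam_leP; first exact: ltW.
  move=> x y [] -> [] ->; rewrite [mdist _ _]dist_length ?subrr ?(length0 hN)//.
  - exact: ltW.
  - by rewrite lengthB.
  - exact: ltW.
have [f hf] := multiplicity_label mulB dA.
have UA : U `&` [set a; b] !=set0 by exists a; split => //; left.
have VA : V `&` [set a; b] !=set0 by exists b; split => //; right.
have [fU eUV] := hf U V BU BV UA VA.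
have [fV _] := hf V U BV BU VA UA.
by rewrite eUV//; move: fU fV; rewrite !ltnS !leqn0 => /eqP-> /eqP->.
Qed.

(** The cover is taken at scale [2 * s] with [s = d 0 x], so that its members
    have diameter at most [D = c * (2 * s)]; the constant is then
    [2 * (D + s) + s = (4 * c + 3) * s]. *)
Lemma monotone_of_dim1_covers : proper_length (d 0) -> forall c, 0 < c ->
  (forall s, 0 < s -> exists B : set (set X),
     bounded_cover (c * s) B /\ (multiplicity s B <= (2%:R)%:E)%E) ->
  forall x t, 0 < t -> t <= x -> d 0 t <= (4 * c + 3) * d 0 x.
Proof.
move=> hN c c0 hcov x t t0 tx.
set s := d 0 x.
have s0 : 0 < s by apply: length_gt0; rewrite ?gt_eqF// (lt_le_trans t0).
have [B [[covB diamB] mulB]] := hcov (2 * s) (mulr_gt0 (ltr0n _ 2) s0).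
have /choice[psi hpsi] : forall v : R, exists U, B U /\ U v.
  move=> v; have : (\bigcup_(U in B) U) (v : X) by rewrite covB.
  by case=> U BU Uv; exists U.
rewrite (_ : (4 * c + 3) * s = 2 * (c * (2 * s) + s) + s); last by lra.
apply: (@cover_length_bound R (d 0) hN s (c * (2 * s)) s0 psi
  _ _ _ _ (lexx _) x) => //.
- by move=> v; have [] := hpsi v.
- move=> v a b va vb; rewrite -dist_length.
  by have [Bv _] := hpsi v; apply: (mdist_le_diam (diamB _ Bv)).
- move=> a b e ab be ae.
  have dA : (@diam R X [set a; b; e] <= (2 * s)%:E)%E.
    have s2 : 0 <= 2 * s by lra.
    apply: diam_leP => //.
    by move=> v w [[]|] -> [[]|] ->; rewrite [mdist _ _]dist_length
      ?subrr ?(length0 hN)// lengthB.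
  have [f hf] := multiplicity_label mulB dA.
  have met v : [set a; b; e] v -> B (psi v) /\ psi v `&` [set a; b; e] !=set0.
    by move=> Av; have [Bv vv] := hpsi v; split => //; exists v.
  have [Ba Ma] := met a ltac:(by left; left).
  have [Bb Mb] := met b ltac:(by left; right).
  have [Be Me] := met e ltac:(by right).
  have [fa eab] := hf _ _ Ba Bb Ma Mb.
  have [fb ebe] := hf _ _ Bb Be Mb Me.
  have [fe eea] := hf _ _ Be Ba Me Ma.
  case: (f (psi a)) (f (psi b)) (f (psi e)) fa fb fe eab ebe eea
     => [|[|//]] [|[|//]] [|[|//]] _ _ _ e1 e2 e3;
  by [apply: Or31; apply: e1 | apply: Or32; apply: e2 | apply: Or33; apply/esym/e3].
Qed.

Lemma connected_metric (S : set R) : @connected X S <-> @connected R S.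
Proof.
have clos (A : set R) : @closed X A <-> @closed R A.
  by rewrite -!openC; apply: d_top.
split=> hS B B0 [C oC eC] [F cF eF].
- by apply: hS => //; [exists C => //; apply/d_top|exists F => //; apply/clos].
- by apply: hS => //; [exists C => //; apply/d_top|exists F => //; apply/clos].
Qed.

Lemma monotone_linearly_connected lambda : proper_length (d 0) -> 1 <= lambda ->
  (forall x t, 0 < t -> t <= x -> d 0 t <= lambda * d 0 x) ->
  linearly_connected X.
Proof.
move=> hN l1 mono; exists lambda; split => //.
have l0 : 0 <= lambda by exact: le_trans l1.
have key (x y : R) : x <= y -> exists S : set X,
    [/\ connected S, S x, S y & (diam S <= (lambda * d x y)%:E)%E].
  move=> xy; exists [set` `[x, y]]; split.
  - by apply/connected_metric/connected_intervalP; exact: interval_is_interval.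
  - by rewrite /= in_itv/= lexx.
  - by rewrite /= in_itv/= lexx andbT.
  - apply: diam_leP => [|a b].
      by rewrite dist_length// mulr_ge0// length_ge0.
    rewrite /= !in_itv/= => /andP[xa ay] /andP[xb b_y].
    rewrite [mdist a b]dist_length (dist_length x).
    wlog ab : a b xa ay xb b_y / a <= b.
      move=> wl; have [|/ltW] := leP a b; first exact: wl.
      by rewrite lengthB//; apply: wl.
    case: (eqVneq a b) => [->|nab].
      by rewrite subrr (length0 hN) mulr_ge0// length_ge0.
    apply: mono; first by rewrite subr_gt0 lt_neqAle nab.
    by apply: lerB.
move=> x y; have [/key//|/ltW/key[S [cS Sy Sx dS]]] := leP (x : R) y.
by exists S; split => //; rewrite [mdist _ _](dist_sym d).
Qed.

Lemma linearly_connected_monotone lambda : proper_length (d 0) ->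
  (forall x y : X, exists S : set X,
      [/\ connected S, S x, S y & (diam S <= (lambda * mdist x y)%:E)%E]) ->
  forall x t, 0 <= t -> t <= x -> d 0 t <= lambda * d 0 x.
Proof.
move=> hN lin x t t0 tx; have [S [cS S0 Sx dS]] := lin 0 x.
have /connected_metric/connected_intervalP itvS := cS.
apply: (mdist_le_diam dS S0 (itvS _ _ S0 Sx t _)).
by rewrite t0.
Qed.

(** The tiles are intervals whose length [L] is at least every [`|v|] with
    [d 0 v <= s], and at most twice such a [v]: the former makes an [s]-bounded
    set meet at most two consecutive tiles, the latter bounds the diameter of
    a tile. *)
Lemma cover_of_monotone lambda : proper_length (d 0) -> 0 < lambda ->
  (forall x t, 0 <= t -> t <= x -> d 0 t <= lambda * d 0 x) ->
  forall s, 0 < s -> exists B : set (set X),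
    bounded_cover (2 * lambda * s) B /\ (multiplicity s B <= (2%:R)%:E)%E.
Proof.
move=> hN l0 mono s s0.
pose P := [set t : R | 0 < t /\ d 0 t <= s].
have [t1 Pt1] : exists t, P t.
  have [eta [eta0 /(_ eta)]] := length_small hN s0.
  by rewrite gtr0_norm// lexx => /(_ isT); exists eta.
have supP : has_sup P.
  split; first by exists t1.
  have [M hM] := length_bounded hN s; exists M => t [t0 /hM].
  by rewrite gtr0_norm// => /ltW.
have sup0 : 0 < sup P.
  by have [t10 _] := Pt1; exact: lt_le_trans t10 (ub_le_sup supP.2 Pt1).
have [t [t0 Nt] tsup] : exists2 t, P t & sup P / 2 < t.
  have [|t Pt ht] := @sup_adherent _ P (sup P / 2) _ supP; first by rewrite divr_gt0.
  by exists t => //; move: ht; lra.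
pose L := 2 * t.
have L0 : 0 < L by rewrite mulr_gt0.
have short v : d 0 v <= s -> `|v| <= L.
  move=> Nv; case: (eqVneq v 0) => [->|v0]; first by rewrite normr0 ltW.
  have Pv : P `|v|.
    split; first by rewrite normr_gt0.
    by case: (ger0P v) => _//; rewrite lengthN.
  by have := ub_le_sup supP.2 Pv; rewrite /L; lra.
pose tile (k : int) : set X := [set v : R | Num.floor (v / L) = k].
exists (range tile); split; first split.
- by apply/seteqP; split => // v _; exists (tile (Num.floor ((v : R) / L))).
- move=> _ [k _ <-]; apply: diam_leP; first by rewrite !mulr_ge0// ltW.
  move=> a b /= ak bk.
  have /andP[a1 a2] := floor_itv ((a : R) / L).
  have /andP[b1 b2] := floor_itv ((b : R) / L).
  rewrite ak bk in a1 a2 b1 b2.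
  move: a1 a2 b1 b2; rewrite !intrD !ler_pdivlMr// !ltr_pdivrMr// => a1 a2 b1 b2.
  have NL : d 0 L <= 2 * s.
    by rewrite /L mulr2n mulrDl mul1r; have := lengthD hN t t; lra.
  have wide w : 0 <= w -> w <= L -> d 0 w <= 2 * lambda * s.
    move=> w0 wL; apply: le_trans (mono _ _ w0 wL) _.
    by rewrite [2 * _]mulrC -mulrA ler_pM2l.
  rewrite [mdist a b]dist_length; case: (leP (a : R) b) => ab.
    by apply: wide; lra.
  by rewrite lengthB//; apply: wide; lra.
apply/nat_inf_leP; exists 2%N => // A dA.
have near k l u v : tile k u -> tile l v -> A u -> A v -> k <= l + 1.
  move=> /= <- <- Au Av; have := mdist_le_diam dA Av Au.
  rewrite [mdist _ _]dist_length => /short /(le_trans (ler_norm _)) uv.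
  rewrite -[1](@floor1 R) -floorDrz ?rpred1//; apply: le_floor.
  by rewrite ler_pdivrMr// mulrDl divfK ?gt_eqF// mul1r -lerBlDl.
pose met k := tile k `&` A !=set0.
have near_met k l : met k -> met l -> k <= l + 1.
  by move=> [u [ku Au]] [v [lv Av]]; apply: (near k l u v).
(* The smallest index met, if any: it is either an arbitrary index met or its
   predecessor. *)
have [m hm] : exists m, forall l, met l -> l = m \/ l = m + 1.
  case: (pselect (exists k, met k)) => [[k mk]|none]; last first.
    by exists 0 => l ml; case: none; exists l.
  case: (pselect (met (k - 1))) => mk1.
    exists (k - 1) => l ml.
    by have := near_met _ _ ml mk1; have := near_met _ _ mk ml; lia.
  exists k => l ml; have := near_met _ _ ml mk; have := near_met _ _ mk ml.
  have : l != k - 1 by apply: contra_notN mk1 => /eqP <-.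
  lia.
apply: card_le_trans (card_image_le (fun n : nat => tile (m + n%:Z)) `I_2).
apply: subset_card_le => _ [[l _ <-] /hm[]->]; last by exists 1%N.
by exists 0%N => //; rewrite addr0.
Qed.

End InvariantDistance.

Theorem theorem1p2 (R : realType) (d : distance R R)
  (d_inv : translation_invariant d)
  (d_top : induces_standard_topology d)
  (d_proper : proper_space (metric_space d)) :
  nagata_dim (metric_space d) = 1%:E%E <->
  linearly_connected (metric_space d).
Proof.
have hN := distance_length d_inv d_top d_proper.
split.
- move=> /nat_inf_eq1P[[c [c0 hc]] _].
  apply: (@monotone_linearly_connected _ _ d_inv d_top (4 * c + 3)) => //.
    by lra.
  exact: monotone_of_dim1_covers.
- move=> [lambda [l1 lin]]; have l0 : 0 < lambda by exact: lt_le_trans l1.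
  apply/nat_inf_eq1P; split.
    exists (2 * lambda); split; first by rewrite mulr_gt0.
    apply: cover_of_monotone => //.
    exact: linearly_connected_monotone.
  by move=> [c [c0 hc]]; apply: (no_dim0_covers _ _ c0 hc).
Qed.
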